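(* Let $D$ be an open interval $(a,b)$ or the circle, and let $f_1,\dots,f_n: D\to\mathbb{R}$ be a Chebyshev system of order $n$ on $D$. Put $m=n$ if $D$ is an interval and $m=n+1$ if $D$ is the circle. Then for any $m$ distinct points $x_1,\dots,x_m\in D$ there exists a continuous function $f: D\to\mathbb{R}$ which changes sign at each of the points $x_1,\dots,x_m$ and nowhere else (so $f$ has exactly $m$ sign changes on $D$, located at $x_1,\dots,x_m$), and which is orthogonal to the given Chebyshev system with weight function $\rho\equiv 1$, i.e. $\int_D f(x)f_i(x)\,dx=0$ for all $i=1,\dots,n$.
   Context: The circle is parametrized by $[0,2\pi]$ with endpoints identified (functions on it are $2\pi$-periodic), and $dx$ is the corresponding measure. A set of continuous functions $f_1,\dots,f_n : D\to\mathbb{R}$ is a Chebyshev system (of order $n$) on $D$ if for any real constants $c_1,\dots,c_n$, not all zero, the function $\sum_{j=1}^n c_jf_j(x)$ vanishes at no more than $n-1$ different points of $D$. (On the circle the order $n$ is necessarily odd.) Sign changes: for a continuous function $f$ on $D$, each connected component of the zero set of $f$ is a point or an interval. The function $f$ changes sign on such a component if in any neighborhood of this component there exist two points at which the values of $f$ have opposite (nonzero) signs. The number of sign changes of $f$ is the number of connected components of the zero set on which $f$ changes sign; from each such component one point is selected, and these points are called the sign changes of $f$. *)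

(* Defs.v *)
From HB Require Import structures.
From mathcomp Require Import all_boot all_order all_algebra.
From mathcomp Require Import all_classical all_reals all_analysis.

Set Implicit Arguments.
Unset Strict Implicit.
Unset Printing Implicit Defensive.

Import Order.TTheory GRing.Theory Num.Theory.
Import numFieldNormedType.Exports.

Local Open Scope classical_set_scope.
Local Open Scope ring_scope.

(* A domain is a subset [D] of a topological space [T]; functions on [D] are
   total functions on [T] of which only the values on [D] matter. *)

Definition zero_set (T : Type) (R : realType) (D : set T) (f : T -> R) : set T :=
  [set x | D x /\ f x = 0].

(* The case [n = 0] is degenerate because of [n.-1]; it is only used for
   [0 < n]. *)
Definition chebyshev_system (R : realType) (T : topologicalType) (D : set T)
    (n : nat) (f : 'I_n -> T -> R) : Prop :=
  (forall j, {within D, continuous (f j)}) /\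
  (forall c : 'I_n -> R, (exists j, c j != 0) ->
     (zero_set D (fun x => \sum_(j < n) c j * f j x) #<= `I_n.-1)%card).

(* [D `&` U], for [U] open in [T] containing [C], ranges over the relatively
   open neighborhoods of [C] in [D]. *)
Definition changes_sign_on (R : realType) (T : topologicalType) (D : set T)
    (f : T -> R) (C : set T) : Prop :=
  forall U : set T, open U -> C `<=` U ->
    exists y z, [/\ (D `&` U) y, (D `&` U) z, f y < 0 & 0 < f z].

Definition sign_change_components (R : realType) (T : topologicalType)
    (D : set T) (f : T -> R) : set (set T) :=
  [set C | (exists2 x, zero_set D f x &
                       C = connected_component (zero_set D f) x)
           /\ changes_sign_on D f C].

(* The points [x i] are the sign changes of [f] on [D]: one point selected in
   each component of the zero set on which [f] changes sign. *)
Definition sign_changes_at (R : realType) (T : topologicalType) (D : set T)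
    (f : T -> R) (m : nat) (x : 'I_m -> T) : Prop :=
  [/\ forall i, exists2 C, sign_change_components D f C & C (x i),
      forall C, sign_change_components D f C -> exists! i, C (x i)
    & (sign_change_components D f #= `I_m)%card].

(* The Lebesgue integral of a non-integrable function is a junk value, hence
   the integrability requirement. *)
Definition integral_zero (R : realType) (A : set R) (h : R -> R) : Prop :=
  lebesgue_measure.-integrable A (EFin \o h) /\
  (\int[lebesgue_measure]_(t in A) (h t)%:E = 0)%E.

(* The endpoints may be infinite. *)
Definition open_interval (R : realType) (a b : \bar R) : set R :=
  [set x | (a < x%:E)%E /\ (x%:E < b)%E].

Definition circle (R : realType) : set (R * R) :=
  [set p | p.1 ^+ 2 + p.2 ^+ 2 = 1].

(* Restricted to [0, 2 pi], this is the parametrization of the circle that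
   identifies the endpoints; the integral over the circle of [h] is that of
   [h \o circle_param] over [0, 2 pi]. *)
Definition circle_param (R : realType) (t : R) : R * R := (cos t, sin t).

(* Main.v *)
(* Fix a continuous [s] changing sign exactly at the prescribed points
   (a product of linear factors on an interval, of chord equations on the
   circle) and look for [g = s * w] with [w > 0].  The vectors of integrals of
   [s * w * f_i] over all admissible weights [w] form a convex cone in [R^n].
   If this cone missed the origin, a hyperplane would separate: for some
   [c <> 0] and [P = \sum_i c_i f_i], the integral of [s * w * P] would be
   nonnegative for every [w], hence [s * P >= 0] on [D], and [P] would vanish
   at every sign change of [s].  These are at least [n] points, contradicting
   the Chebyshev property.  On the circle the chords pair up the [n + 1]
   points, which requires [n] to be odd. *)

Require Import Defs.
From HB Require Import structures.
From mathcomp Require Import all_boot all_order all_algebra perm.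
From mathcomp Require Import all_classical all_reals all_analysis.
From mathcomp Require Import measurable_realfun ring lra.

Set Implicit Arguments.
Unset Strict Implicit.
Unset Printing Implicit Defensive.

Import Order.TTheory GRing.Theory Num.Theory.
Import numFieldNormedType.Exports.

Local Open Scope classical_set_scope.
Local Open Scope ring_scope.

(** * Separating a convex cone from the origin *)

(** Induction on [n]. If coordinate [n] keeps a weak sign on [K], that coordinate, up to sign, is
    the functional. Otherwise the slice where it vanishes is a nonempty cone, and a functional
    nonnegative on the slice extends to [K] by a suitable last coefficient. Vectors are sequences,
    so the slice needs no change of type. *)
Lemma cone_separation (R : realType) (n : nat) (K : set (nat -> R)) :
  (forall u v a b, K u -> K v -> 0 < a -> 0 < b ->
     K (fun i => a * u i + b * v i)) ->
  K !=set0 ->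
  (exists2 u, K u & forall i, (i < n)%N -> u i = 0) \/
  (exists2 c : nat -> R, (exists2 i, (i < n)%N & c i != 0) &
     forall u, K u -> 0 <= \sum_(i < n) c i * u i).
Proof.
elim: n K => [|n IHn] K coneK [u0 Ku0]; first by left; exists u0.
have sumE (c : nat -> R) (d : R) (u : nat -> R) :
    \sum_(i < n.+1) (if i == n :> nat then d else c i) * u i =
    \sum_(i < n) c i * u i + d * u n.
  rewrite big_ord_recr /= eqxx; congr (_ + _); apply: eq_bigr => i _.
  by rewrite (ltn_eqF (ltn_ord i)).
have [Kge0|/existsNP[u /not_implyP[Ku /negP]]] :=
    pselect (forall u, K u -> 0 <= u n).
  right; exists (fun i => if i == n then 1 else 0) => [|u Ku].
    by exists n; rewrite ?eqxx ?oner_neq0.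
  by rewrite (sumE (fun=> 0) 1) big1 ?add0r ?mul1r ?Kge0// => i _; rewrite mul0r.
rewrite -ltNge => un.
have [Kle0|/existsNP[v /not_implyP[Kv /negP]]] :=
    pselect (forall u, K u -> u n <= 0).
  right; exists (fun i => if i == n then -1 else 0) => [|w Kw].
    by exists n; rewrite ?eqxx ?oppr_eq0 ?oner_neq0.
  rewrite (sumE (fun=> 0) (-1)) big1 ?add0r ?mulN1r ?oppr_ge0 ?Kle0// => i _.
  by rewrite mul0r.
rewrite -ltNge => vn.
pose K0 := [set w | K w /\ w n = 0].
(* The positive combination that cancels coordinate [n]. *)
have K0E w1 w2 : K w1 -> K w2 -> w1 n < 0 -> 0 < w2 n ->
    K0 (fun i => w2 n * w1 i + - w1 n * w2 i).
  by move=> Kw1 Kw2 w1n w2n; split; [apply: coneK; rewrite ?oppr_gt0|lra].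
have [| |[w [Kw wn] w0]|[c [i ltin ci] cge0]] := IHn K0.
- move=> w1 w2 a b [Kw1 w1n] [Kw2 w2n] a0 b0; split; first exact: coneK.
  by rewrite w1n w2n !mulr0 addr0.
- by exists (fun i => v n * u i + - u n * v i); exact: K0E.
- left; exists w => // i; rewrite ltnS leq_eqVlt => /predU1P[->//|]; exact: w0.
right; pose l w := \sum_(i < n) c i * w i.
have le_slopes w1 w2 : K w1 -> K w2 -> w1 n < 0 -> 0 < w2 n ->
    - l w2 / w2 n <= - l w1 / w1 n.
  move=> Kw1 Kw2 w1n w2n; have := cge0 _ (K0E _ _ Kw1 Kw2 w1n w2n).
  have -> : \sum_(i < n) c i * (w2 n * w1 i + - w1 n * w2 i) =
            w2 n * l w1 + - w1 n * l w2.
    rewrite !mulr_sumr -big_split/=; apply: eq_bigr => j _; ring.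
  by move=> h; rewrite ler_pdivrMr// mulrAC ler_ndivlMr//; lra.
(* A last coefficient [d] must satisfy [l w + d * w n >= 0]: the [w] with [w n > 0] bound [d] from
   below, those with [w n < 0] from above. By [le_slopes] the bounds are compatible, so the supremum
   of the lower ones works. *)
pose S := [set - l w / w n | w in [set w | K w /\ 0 < w n]].
exists (fun i => if i == n then sup S else c i) => [|w Kw].
  by exists i; [exact: ltnW|rewrite (ltn_eqF ltin)].
rewrite sumE -/(l w); have [wn|wn|wn] := ltgtP (w n) 0.
- have : sup S <= - l w / w n.
    apply: ge_sup; first by exists (- l v / v n); exists v.
    by move=> _ [w2 [Kw2 w2n] <-]; exact: le_slopes.
  by rewrite ler_ndivlMr//; lra.
- have : - l w / w n <= sup S.
    apply: ub_le_sup; last by exists w.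
    by exists (- l u / u n) => _ [w2 [Kw2 w2n] <-]; exact: le_slopes.
  by rewrite ler_pdivrMr//; lra.
- by rewrite wn mulr0 addr0; exact: cge0.
Qed.

(** * Continuity relative to a subset *)

Lemma within_continuous_sum (R : realType) (T : topologicalType) (D : set T)
    (I : Type) (r : seq I) (F : I -> T -> R) :
  (forall i, {within D, continuous (F i)}) ->
  {within D, continuous (fun x => \sum_(i <- r) F i x)}.
Proof.
move=> cF; apply: (@continuous_big R I +%R 0 xpredT _ (subspace D)).
  exact: add_continuous.
by move=> i _; exact: cF.
Qed.

Lemma within_continuous_prod (R : realType) (T : topologicalType) (D : set T)
    (I : Type) (r : seq I) (P : pred I) (F : I -> T -> R) :
  (forall i, {within D, continuous (F i)}) ->
  {within D, continuous (fun x => \prod_(i <- r | P i) F i x)}.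
Proof.
move=> cF; apply: (@continuous_big R I *%R 1 P _ (subspace D)).
  exact: mul_continuous.
by move=> i _; exact: cF.
Qed.

Lemma within_continuous_precomp (S T U : topologicalType) (A : set S) (D : set T)
    (phi : S -> T) (f : T -> U) :
  continuous phi -> (forall t, A t -> D (phi t)) ->
  {within D, continuous f} -> {within A, continuous (f \o phi)}.
Proof.
move=> cphi phiA /subspace_continuousP cf; apply/subspace_continuousP => t At.
move=> B /(cf _ (phiA _ At)) DB.
have phiB : \forall x \near t, D (phi x) -> B (f (phi x)) by exact: cphi DB.
change (\forall x \near t, A x -> B (f (phi x))).
by apply: filterS phiB => x h Ax; exact/h/phiA.
Qed.

(** * Integrals of functions continuous on a set *)

(** This lets almost-everywhere statements about continuous functions hold everywhere; unlike
    openness, it also covers the closed segment [[0, 2 pi]]. *)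
Definition fat_points (R : realType) (A : set R) :=
  forall t (U : set R), A t -> open U -> U t ->
    (0 < lebesgue_measure (A `&` U))%E.

(** A zero integral makes [h] vanish almost everywhere, whereas [0 < h t] would persist on a
    relative neighborhood of [t], which has positive measure by fatness. *)
Lemma integral_within_continuous_eq0 (R : realType) (A : set R) (h : R -> R) :
  measurable A -> fat_points A ->
  {within A, continuous h} -> (forall t, A t -> 0 <= h t) ->
  (\int[lebesgue_measure]_(t in A) (h t)%:E = 0)%E ->
  forall t, A t -> h t = 0.
Proof.
move=> mA fatA ch h0 inth t At.
have mh : measurable_fun A (EFin \o h).
  by apply/measurable_EFinP; exact: subspace_continuous_measurable_fun.
have /(ae_eq_integral_abs lebesgue_measure mA mh).1 aeh :
    (\int[lebesgue_measure]_(t in A) `|(EFin \o h) t| = 0)%E.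
  rewrite -inth; apply: eq_integral => x /set_mem Ax.
  by rewrite gee0_abs// lee_fin h0.
apply: contrapT => /eqP; rewrite eq_le h0// andbT -ltNge => ht.
have /open_subspaceP[U oU UA] : open ([set x | 0 < h x] : set (subspace A)).
  have /continuousP ch' : continuous (h : subspace A -> R) by [].
  by apply: (ch' [set x | 0 < x]); exact: open_gt.
have [N [mN N0 hN]] := aeh.
have AUN : A `&` U `<=` N.
  move=> x [Ax Ux]; apply: hN => /(_ Ax)[hx0].
  have : (U `&` A) x by [].
  by rewrite UA /= => -[]; rewrite hx0 ltxx.
have muAU : (lebesgue_measure (A `&` U) <= 0)%E.
  rewrite -N0; apply: le_measure; rewrite ?inE//.
  by apply: measurableI => //; exact: open_measurable.
have : (U `&` A) t by rewrite UA.
by move=> [Ut _]; have := lt_le_trans (fatA _ _ At oU Ut) muAU; rewrite ltxx.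
Qed.

Lemma EFin_Rintegral (R : realType) (A : set R) (h : R -> R) :
  measurable (A : set (measurableTypeR R)) ->
  lebesgue_measure.-integrable A (EFin \o h) ->
  (\int[lebesgue_measure]_(t in A) (h t)%:E)%E =
  (\int[lebesgue_measure]_(t in A) h t)%:E.
Proof. by move=> mA hint; rewrite fineK//; exact: integrable_fin_num. Qed.

Lemma integrable_combination (R : realType) (A : set R) (n : nat)
    (h : 'I_n -> R -> R) (c : 'I_n -> R) :
  measurable (A : set (measurableTypeR R)) ->
  (forall i, lebesgue_measure.-integrable A (EFin \o h i)) ->
  lebesgue_measure.-integrable A
    (EFin \o (fun t => \sum_i c i * h i t)) /\
  \int[lebesgue_measure]_(t in A) (\sum_i c i * h i t) =
  \sum_i c i * \int[lebesgue_measure]_(t in A) h i t.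
Proof.
move=> mA hint; have cint i :
    lebesgue_measure.-integrable A (EFin \o (fun t => c i * h i t)).
  by have := integrableZl mA (c i) (hint i); apply: eq_integrable.
elim: (index_enum _) => [|i r [IHint IHeq]].
  split; last by under eq_Rintegral do rewrite big_nil;
    rewrite big_nil Rintegral_cst// mul0r.
  by apply: eq_integrable (integrable0 _ _) => // t _ /=; rewrite big_nil.
split.
  apply: eq_integrable (integrableD mA (cint i) IHint) => // t _ /=.
  by rewrite big_cons EFinD.
under eq_Rintegral do rewrite big_cons.
by rewrite RintegralD// IHeq big_cons RintegralZl.
Qed.

(** * The dichotomy between an orthogonal weight and a one-signed combination *)

(** The two outcomes of [cone_separation] for the vectors of integrals. The map [phi] transports
    integrals from [A] to [D], so one statement serves both domains; the positive integrable [psi]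
    compensates for [f i] that need not be integrable. *)
Lemma orthogonal_weight_or_sign (R : realType) (T : topologicalType)
    (D : set T) (A : set R) (phi : R -> T) (n : nat) (f : 'I_n -> T -> R)
    (s psi : T -> R) :
  measurable (A : set (measurableTypeR R)) -> fat_points A -> continuous phi ->
  (forall t, A t -> D (phi t)) -> D `<=` phi @` A ->
  (forall i, {within D, continuous (f i)}) -> {within D, continuous s} ->
  {within D, continuous psi} -> (forall p, D p -> 0 < psi p) ->
  lebesgue_measure.-integrable A (EFin \o (psi \o phi)) ->
  (exists w : T -> R, [/\ {within D, continuous w},
     forall p, D p -> 0 < w p &
     forall i, integral_zero A
       (fun t => s (phi t) * w (phi t) * f i (phi t))]) \/
  (exists2 c : 'I_n -> R, exists j, c j != 0 &
     forall p, D p -> 0 <= s p * \sum_i c i * f i p).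
Proof.
move=> mA fatA cphi phiA phiD cf cs cpsi psi0 psiint.
have dominated (q : T -> R) M : {within D, continuous q} ->
    (forall p, D p -> `|q p| <= M * psi p) ->
    lebesgue_measure.-integrable A (EFin \o (q \o phi)).
  move=> cq qM.
  apply: (le_integrable mA _ _ (integrableZl mA M psiint)).
    apply/measurable_EFinP; apply: subspace_continuous_measurable_fun => //.
    exact: within_continuous_precomp cphi phiA cq.
  move=> t /phiA Dt; rewrite lee_fin/= (le_trans (qM _ Dt))//.
  exact: ler_norm.
(* The denominators make every integrand met below dominated by [psi]. *)
pose nrm p := 1 + \sum_(i < n) `|s p * f i p|.
pose den (q : T -> R) p := nrm p * (1 + `|q p|) ^+ 2.
pose W (q : T -> R) p := psi p / den q p.
(* The negative part of [q]. The square in [den] is there to absorb [neg q ^+ 2], and [nrm] absorbs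
   each [s * f i]. *)
pose neg (q : T -> R) p := (`|q p| - q p) / 2.
have nrm1 p : 1 <= nrm p by rewrite lerDl sumr_ge0.
have den1 q p : 1 <= den q p.
  by rewrite mulr_ege1// exprn_ege1// lerDl.
have den0 q p : 0 < den q p by rewrite (lt_le_trans ltr01).
have W0 q p : D p -> 0 < W q p by move=> Dp; rewrite divr_gt0 ?psi0.
have neg_ge0 q p : 0 <= neg q p by rewrite divr_ge0// subr_ge0 ler_norm.
have neg_le q p : neg q p <= `|q p|.
  by rewrite /neg; have := ler_norm (- q p); rewrite normrN; lra.
have mul_neg q p : q p * neg q p = - neg q p ^+ 2.
  by rewrite /neg; case: (ger0P (q p)) => _; field.
have cden q : {within D, continuous q} -> {within D, continuous (den q)}.
  move=> cq x; apply: (@cvgM _ (subspace D)).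
    apply: (@cvgD _ _ (subspace D)); first exact: cvg_cst.
    apply: within_continuous_sum => i y.
    by apply: (@cvg_norm _ _ (subspace D)); apply: (@cvgM _ (subspace D));
      [exact: cs|exact: cf].
  by apply: (@cvgM _ (subspace D)); (apply: (@cvgD _ _ (subspace D));
    [exact: cvg_cst|apply: (@cvg_norm _ _ (subspace D)); exact: cq]).
have cW q : {within D, continuous q} -> {within D, continuous (W q)}.
  move=> cq x; apply: (@cvgM _ (subspace D)); first exact: cpsi.
  by apply: (@cvgV _ (subspace D)); [rewrite gt_eqF|exact: cden].
have cneg q : {within D, continuous q} -> {within D, continuous (neg q)}.
  move=> cq x; apply: (@cvgM _ (subspace D)); last exact: cvg_cst.
  apply: (@cvgB _ _ (subspace D)); last exact: cq.
  by apply: (@cvg_norm _ _ (subspace D)); exact: cq.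
have W_dominated q (r : T -> R) M :
    {within D, continuous q} -> {within D, continuous r} ->
    (forall p, D p -> `|r p| <= M * den q p) ->
    lebesgue_measure.-integrable A (EFin \o (fun t => r (phi t) * W q (phi t))).
  move=> cq cr rM; apply: (dominated (fun p => r p * W q p) M).
    by move=> x; apply: (@cvgM _ (subspace D)); [exact: cr|exact: cW].
  move=> p Dp; rewrite normrM [`|W q p|]gtr0_norm ?W0//.
  by rewrite mulrA ler_pdivrMr// mulrAC ler_wpM2r ?rM// ltW// psi0.
(* The admissible weights; requiring integrability makes [L] additive on [K]. *)
pose K := [set w : T -> R | [/\ {within D, continuous w},
  forall p, D p -> 0 < w p & forall i, lebesgue_measure.-integrable A
    (EFin \o (fun t => s (phi t) * w (phi t) * f i (phi t)))]].
pose L (w : T -> R) i := \int[lebesgue_measure]_(t in A)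
  (s (phi t) * w (phi t) * f i (phi t)).
have KW q e : {within D, continuous q} -> 0 < e ->
    K (fun p => W q p * (e + neg q p)).
  move=> cq e0; split=> [x|p Dp|i].
  - apply: (@cvgM _ (subspace D)); first exact: cW.
    by apply: (@cvgD _ _ (subspace D)); [exact: cvg_cst|exact: cneg].
  - by rewrite mulr_gt0 ?W0// ltr_wpDr.
  - have : lebesgue_measure.-integrable A (EFin \o (fun t =>
        (s (phi t) * f i (phi t) * (e + neg q (phi t))) * W q (phi t))).
      apply: (W_dominated q (fun p => s p * f i p * (e + neg q p)) (1 + e)) => //.
        move=> x; apply: (@cvgM _ (subspace D)).
          by apply: (@cvgM _ (subspace D)); [exact: cs|exact: cf].
        by apply: (@cvgD _ _ (subspace D)); [exact: cvg_cst|exact: cneg].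
      move=> p Dp; rewrite normrM /den mulrCA ler_pM//.
        by rewrite /nrm (bigD1 i)//= addrCA lerDl addr_ge0// sumr_ge0.
      rewrite ger0_norm; last by rewrite addr_ge0// ltW.
      have := neg_le q p; have := normr_ge0 (q p); nra.
    by apply: (eq_integrable mA) => t _ /=; congr EFin; ring.
(* Pads a vector by zeros into a sequence, the format of [cone_separation]. *)
pose emb (v : 'I_n -> R) k := oapp v 0 (insub k).
have embE v (i : 'I_n) : emb v i = v i by rewrite /emb valK.
have [||[u [w [cw w0 wint] uL] u0]|[c [i ltin ci] cge0]] :=
    @cone_separation R n [set u | exists2 w, K w & forall i : 'I_n, u i = L w i].
- move=> u v a b [w1 [cw1 w10 w1int] uw1] [w2 [cw2 w20 w2int] vw2] a0 b0.
  have wE i t : s (phi t) * (a * w1 (phi t) + b * w2 (phi t)) * f i (phi t) =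
      a * (s (phi t) * w1 (phi t) * f i (phi t)) +
      b * (s (phi t) * w2 (phi t) * f i (phi t)) by ring.
  have aint i := integrableZl mA a (w1int i).
  have bint i := integrableZl mA b (w2int i).
  exists (fun p => a * w1 p + b * w2 p) => [|i].
    split=> [x|p Dp|i].
    + by apply: (@cvgD _ _ (subspace D)); apply: (@cvgM _ (subspace D));
        [exact: cvg_cst|exact: cw1|exact: cvg_cst|exact: cw2].
    + by rewrite addr_gt0// mulr_gt0// ?w10 ?w20.
    + apply: (eq_integrable mA _ _ _ (integrableD mA (aint i) (bint i))) => t _ /=.
      by rewrite wE.
  rewrite uw1 vw2 /L; under [RHS]eq_Rintegral do rewrite wE.
  rewrite (RintegralD mA (aint i) (bint i)).
  by rewrite (RintegralZl _ mA (w1int i)) (RintegralZl _ mA (w2int i)).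
- exists (emb (L (fun p => W (cst 0) p * (1 + neg (cst 0) p)))).
  by eexists; [apply: (KW (cst 0) 1) => // x; exact: cvg_cst|exact: embE].
- left; exists w; split=> // i; split; first exact: wint.
  by rewrite EFin_Rintegral// -/(L w i) -uL u0.
right; exists (fun i => c i); first by exists (Ordinal ltin).
pose q p := s p * \sum_(i < n) c i * f i p.
(* Testing with [w := W q * (e + neg q)] gives [I2 <= e * I1] below, so
   [e -> 0] kills the integral of [neg q ^+ 2 * W q]. *)
have cq : {within D, continuous q}.
  move=> x; apply: (@cvgM _ (subspace D)); first exact: cs.
  apply: within_continuous_sum => j y.
  by apply: (@cvgM _ (subspace D)); [exact: cvg_cst|exact: cf].
have absq_le p : (1 + `|q p|) ^+ 2 <= den q p.
  by rewrite ler_peMl// exprn_ge0// addr_ge0.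
have int1 : lebesgue_measure.-integrable A
    (EFin \o (fun t => q (phi t) * W q (phi t))).
  apply: (W_dominated _ _ 1) => // p _; rewrite mul1r (le_trans _ (absq_le p))//.
  by have := normr_ge0 (q p); nra.
have int2 : lebesgue_measure.-integrable A
    (EFin \o (fun t => neg q (phi t) ^+ 2 * W q (phi t))).
  apply: (W_dominated _ (fun p => neg q p ^+ 2) 1) => //.
    by move=> x; apply: (@cvgM _ (subspace D)); exact: cneg.
  move=> p _; rewrite mul1r (le_trans _ (absq_le p))// normrX ger0_norm//.
  rewrite lerXn2r ?nnegrE ?addr_ge0// (le_trans (neg_le q p))// lerDr//.
pose I1 := \int[lebesgue_measure]_(t in A) (q (phi t) * W q (phi t)).
pose I2 := \int[lebesgue_measure]_(t in A) (neg q (phi t) ^+ 2 * W q (phi t)).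
have I12 e : 0 < e -> I2 <= e * I1.
  move=> e0; pose w p := W q p * (e + neg q p).
  have Kw : K w by exact: KW.
  have := cge0 (emb (L w)) (ex_intro2 _ _ w Kw (embE (L w))).
  under eq_bigr do rewrite embE.
  have [_ _ wint] := Kw.
  have [_ <-] := integrable_combination (fun i => c i) mA wint.
  have e_int : lebesgue_measure.-integrable A
      (EFin \o (fun t => e * (q (phi t) * W q (phi t)))).
    by have := integrableZl mA e int1; apply: eq_integrable.
  (* Pointwise, [q * w = W q * (e * q + q * neg q) = W q * (e * q - neg q ^+ 2)]. *)
  suff -> : \int[lebesgue_measure]_(t in A)
      (\sum_(i < n) c i * (s (phi t) * w (phi t) * f i (phi t))) = e * I1 - I2.
    by rewrite subr_ge0.
  rewrite -RintegralZl// -RintegralB//; apply: eq_Rintegral => t _.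
  transitivity (q (phi t) * w (phi t)).
    by rewrite /q mulr_sumr mulr_suml; apply: eq_bigr => j _; ring.
  have := mul_neg q (phi t); rewrite /w => qneg.
  transitivity (W q (phi t) * (e * q (phi t) + q (phi t) * neg q (phi t))).
    by ring.
  by rewrite qneg; ring.
have I2_0 : I2 = 0.
  apply/eqP; rewrite eq_le Rintegral_ge0 ?andbT; last first.
    by move=> t /phiA Dt; rewrite mulr_ge0 ?sqr_ge0// ltW// W0.
  (* With [e = I2 / (2 * (1 + |I1|))], the bound [I12] would give [2 * (1 + |I1|) <= I1]. *)
  rewrite leNgt; apply/negP => I2gt0.
  have I1_0 : 0 < 2 * (1 + `|I1|) by rewrite mulr_gt0// ltr_wpDr.
  have := I12 _ (divr_gt0 I2gt0 I1_0).
  rewrite mulrAC ler_pdivlMr// ler_pM2l//.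
  have := ler_norm I1; have := normr_ge0 I1; lra.
have neg0 t : A t -> neg q (phi t) ^+ 2 * W q (phi t) = 0.
  apply: (integral_within_continuous_eq0 (h := fun t =>
    neg q (phi t) ^+ 2 * W q (phi t)) mA fatA) => [|x /phiA Dx|].
  - apply: (within_continuous_precomp
      (f := fun p => neg q p ^+ 2 * W q p) cphi phiA) => x.
    apply: (@cvgM _ (subspace D)); last exact: cW.
    by apply: (@cvgM _ (subspace D)); exact: cneg.
  - by rewrite mulr_ge0 ?sqr_ge0// ltW// W0.
  - by rewrite EFin_Rintegral// -/I2 I2_0.
(* As [W q > 0], the negative part vanishes, so [q] equals its absolute value. *)
move=> _ /phiD[t At <-]; have /eqP := neg0 t At.
rewrite mulf_eq0 (gt_eqF (W0 _ _ (phiA _ At))) orbF sqrf_eq0.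
rewrite mulf_eq0 invr_eq0 pnatr_eq0 orbF subr_eq0 => /eqP.
by rewrite -/(q _) => <-.
Qed.

(** * Sign changes, zeros and the Chebyshev bound *)

Lemma within_continuous_pos (R : realType) (T : topologicalType) (D : set T)
    (r : T -> R) (x : T) :
  D x -> {within D, continuous r} -> 0 < r x ->
  exists U : set T, [/\ open U, U x & forall p, D p -> U p -> 0 < r p].
Proof.
move=> Dx /continuousP cr rx.
have /open_subspaceP[U oU UD] : open ([set p | 0 < r p] : set (subspace D)).
  by apply: (cr [set y | 0 < y]); exact: open_gt.
exists U; split=> // [|p Dp Up].
  by have : ([set p | 0 < r p] `&` D) x by []; rewrite -UD => -[].
by have : (U `&` D) p by []; rewrite UD => -[].
Qed.

(** If [P x] were nonzero, [P] would keep its sign near [x] (tested by [P p * P x > 0]), while [s]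
    takes both signs there, making [s * P] negative somewhere. *)
Lemma eq0_at_sign_change (R : realType) (T : topologicalType) (D : set T)
    (s P : T -> R) (x : T) :
  D x -> changes_sign_on D s [set x] -> {within D, continuous P} ->
  (forall p, D p -> 0 <= s p * P p) -> P x = 0.
Proof.
move=> Dx sx cP sP; apply: contrapT => /eqP Px.
have [|||U [oU Ux UP]] := @within_continuous_pos R T D (fun p => P p * P x) x => //.
- by move=> p; apply: (@cvgM _ (subspace D)); [exact: cP|exact: cvg_cst].
- by rewrite -expr2 exprn_even_gt0.
have [|y [z [[Dy Uy] [Dz Uz] sy sz]]] := sx U oU; first by move=> _ ->.
have := UP y Dy Uy; have := UP z Dz Uz; have := sP y Dy; have := sP z Dz.
by rewrite pmulr_rge0// nmulr_rge0// => Pz Py; nra.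
Qed.

(** In a T1 space a finite set is discrete, so [[set x]] is relatively clopen in its connected
    component. *)
Lemma connected_component_finite (T : topologicalType) (A : set T) (x : T) :
  accessible_space T -> finite_set A -> A x ->
  connected_component A x = [set x].
Proof.
move=> accT finA Ax; set C := connected_component A x.
have CA : C `<=` A by exact: connected_component_sub.
have Cx : C x by exact: connected_component_refl.
apply/esym; apply: (@component_connected _ A x) => [|| ].
- by exists x.
- exists (~` (C `\ x)).
    have closed_finite := (@accessible_finite_set_closed T).1 accT.
    apply: closed_openC; apply: closed_finite.
    by apply: sub_finite_set finA => y [/CA].
  rewrite eqEsubset; split=> [_ ->|y [Cy /= /not_andP[//|/contrapT->//]]].
  by split=> // -[_ /(_ erefl)].
- exists [set x]; first exact: accessible_closed_set1.
  by rewrite setIC eqEsubset; split=> [_ ->|y []].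
Qed.

(** With finitely many zeros every component is a singleton, which reduces the definition to a check
    at each [x k]. *)
Lemma sign_changes_at_finite (R : realType) (T : topologicalType) (D : set T)
    (g : T -> R) (m : nat) (x : 'I_m -> T) :
  accessible_space T -> injective x -> zero_set D g = range x ->
  (forall k, changes_sign_on D g [set x k]) -> sign_changes_at D g x.
Proof.
move=> accT injx Zx gx.
have finZ : finite_set (zero_set D g) by rewrite Zx; apply/finite_image/finite_finset.
have compE : sign_change_components D g = [set [set x k] | k in setT].
  rewrite eqEsubset; split=> [C [[y Zy ->] _]|_ [k _ <-]].
    move: (Zy); rewrite {1}Zx => -[k _ <-]; exists k => //.
    by rewrite connected_component_finite// Zx; exists k.
  split=> //; exists (x k); first by rewrite Zx; exists k.
  by rewrite connected_component_finite// Zx; exists k.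
rewrite /sign_changes_at compE; split=> [k|_ [k _ <-]|].
- by exists [set x k] => //; exists k.
- by exists k; split=> // j /injx.
- apply: (card_eq_trans (inj_card_eq _)); last by rewrite card_eq_sym card_II.
  by move=> j k _ _ xjk; apply: injx; have : [set x j] (x j) by []; rewrite xjk.
Qed.

Lemma chebyshev_zeros (R : realType) (T : topologicalType) (D : set T)
    (n m : nat) (f : 'I_n -> T -> R) (c : 'I_n -> R) (x : 'I_m -> T) :
  (0 < n)%N -> chebyshev_system D f -> (exists j, c j != 0) -> injective x ->
  (forall k, D (x k) /\ \sum_j c j * f j (x k) = 0) -> (m < n)%N.
Proof.
move=> n0 [_ chf] c0 injx Zx.
have Zsub : range x `<=` zero_set D (fun p => \sum_j c j * f j p).
  by move=> _ [k _ <-]; exact: Zx.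
have rangeI : (range x #= `I_m)%card.
  apply: (card_eq_trans (inj_card_eq _)); last by rewrite card_eq_sym card_II.
  by move=> j k _ _ /injx.
have := card_le_trans (subset_card_le Zsub) (chf c c0).
by rewrite (card_le_eql rangeI) card_le_II -ltnS prednK.
Qed.

(** * The orthogonality argument common to both domains *)

Lemma chebyshev_orthogonal (R : realType) (T : topologicalType)
    (D : set T) (A : set R) (phi : R -> T) (n m : nat) (f : 'I_n -> T -> R)
    (s psi : T -> R) (x : 'I_m -> T) :
  accessible_space T ->
  measurable (A : set (measurableTypeR R)) -> fat_points A -> continuous phi ->
  (forall t, A t -> D (phi t)) -> D `<=` phi @` A ->
  {within D, continuous psi} -> (forall p, D p -> 0 < psi p) ->
  lebesgue_measure.-integrable A (EFin \o (psi \o phi)) ->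
  (0 < n <= m)%N -> chebyshev_system D f ->
  injective x -> {within D, continuous s} -> zero_set D s = range x ->
  (forall k, changes_sign_on D s [set x k]) ->
  exists g : T -> R,
    [/\ {within D, continuous g}, sign_changes_at D g x
      & forall i, integral_zero A (fun t => g (phi t) * f i (phi t))].
Proof.
move=> accT mA fatA cphi phiA phiD cpsi psi0 psiint /andP[n0 nm] [cf chf] injx
  cs sZ sx.
have Dx k : D (x k) by have [] : zero_set D s (x k) by rewrite sZ; exists k.
have [[w [cw w0 wint]]|[c c0 cge0]] :=
  orthogonal_weight_or_sign mA fatA cphi phiA phiD cf cs cpsi psi0 psiint.
  exists (fun p => s p * w p); split=> //.
    by move=> p; apply: (@cvgM _ (subspace D)); [exact: cs|exact: cw].
  apply: sign_changes_at_finite => //.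
    rewrite -sZ; apply/seteqP; split=> p [Dp gp]; split=> //.
      move/eqP: gp; rewrite mulf_eq0 [w p == 0]gt_eqF ?w0// orbF.
      by move=> /eqP.
    by rewrite gp mul0r.
  move=> k U oU xU; have [y [z [DUy DUz sy sz]]] := sx k U oU xU.
  have [[Dy _] [Dz _]] := (DUy, DUz).
  by exists y, z; split=> //; [rewrite pmulr_llt0 ?w0|rewrite mulr_gt0 ?w0].
(* In this alternative [P] would vanish at all [m >= n] points [x k]. *)
pose P p := \sum_i c i * f i p.
have cP : {within D, continuous P}.
  apply: within_continuous_sum => i p.
  by apply: (@cvgM _ (subspace D)); [exact: cvg_cst|exact: cf].
have := chebyshev_zeros n0 (conj cf chf) c0 injx (fun k =>
  conj (Dx k) (eq0_at_sign_change (Dx k) (sx k) cP cge0)).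
by rewrite ltnNge nm.
Qed.

(** Near [x] the factor [r] has constant sign; if it is negative, the two witnesses for [l] trade
    places. *)
Lemma changes_sign_mul (R : realType) (T : topologicalType) (D : set T)
    (l r : T -> R) (x : T) :
  D x -> changes_sign_on D l [set x] -> {within D, continuous r} -> r x != 0 ->
  changes_sign_on D (fun p => l p * r p) [set x].
Proof.
move=> Dx lx cr rx U oU xU.
have [|||V [oV Vx rV]] := @within_continuous_pos R T D (fun p => r p * r x) x => //.
- by move=> p; apply: (@cvgM _ (subspace D)); [exact: cr|exact: cvg_cst].
- by rewrite -expr2 exprn_even_gt0.
have [|_ ->|y [z [[Dy [Uy Vy]] [Dz [Uz Vz]] ly lz]]] := lx (U `&` V).
- exact: openI.
- by split=> //; exact: xU.
have := rV y Dy Vy; have := rV z Dz Vz.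
move: rx; rewrite neq_lt => /orP[rx|rx] rz ry.
  by exists z, y; split=> //; nra.
by exists y, z; split=> //; nra.
Qed.

(** * The open interval *)

Lemma fat_points_itv (R : realType) (A : set R) :
  measurable (A : set (measurableTypeR R)) ->
  (forall t e, A t -> 0 < e ->
     exists a b, a < b /\ `]a, b[ `<=` A `&` ball t e) ->
  fat_points A.
Proof.
move=> mA itvA t U At oU Ut.
have /nbhs_ballP[e /= e0 eU] : nbhs t U by exact: open_nbhs_nbhs.
have [a [b [ab abA]]] := itvA t e At e0.
have : (lebesgue_measure (`]a, b[ : set R) <= lebesgue_measure (A `&` U))%E.
  apply: le_measure; rewrite ?inE//.
    by apply: measurableI => //; exact: open_measurable.
  by move=> y /abA[Ay /eU].
by apply: lt_le_trans; rewrite lebesgue_measure_itv/= lte_fin ab -EFinB lte_fin subr_gt0.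
Qed.

Lemma open_open_interval (R : realType) (a b : \bar R) : open (open_interval a b).
Proof.
have -> : open_interval a b =
    [set x | (a < x%:E)%E] `&` [set x | (x%:E < b)%E] by [].
by apply: openI; [exact: open_ereal_gt|exact: open_ereal_lt].
Qed.

Lemma chebyshev_orthogonal_interval (R : realType) (n : nat) (n_gt0 : (0 < n)%N)
    (a b : \bar R) (f : 'I_n -> R -> R) :
  chebyshev_system (open_interval a b) f ->
  forall x : 'I_n -> R,
    injective x -> (forall k, open_interval a b (x k)) ->
    exists g : R -> R,
      [/\ {within open_interval a b, continuous g},
          sign_changes_at (open_interval a b) g x
        & forall i, integral_zero (open_interval a b) (fun t => g t * f i t)].
Proof.
set D := open_interval a b => chf x injx Dx.
have oD : open D by exact: open_open_interval.
have mD : measurable (D : set (measurableTypeR R)) by exact: open_measurable.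
have ball_in t : D t -> exists2 e, 0 < e & ball t e `<=` D.
  move=> Dt; have /nbhs_ballP[e /= e0 eU] := open_nbhs_nbhs (conj oD Dt).
  by exists e.
have cfactor k : {within D, continuous (fun t => t - x k)}.
  apply: continuous_subspaceT => t.
  by apply: cvgB; [exact: cvg_id|exact: cvg_cst].
pose s t := \prod_k (t - x k).
(* The Gaussian is positive and integrable on the whole line, hence a valid [psi] even for infinite
   endpoints. *)
apply: (chebyshev_orthogonal (phi := id) (psi := gauss_fun) (s := s)) => //.
- exact/hausdorff_accessible/Rhausdorff.
- apply: fat_points_itv => // t e /ball_in[d d0 dD] e0.
  have m0 : 0 < Num.min d e by rewrite lt_min d0.
  exists (t - Num.min d e), (t + Num.min d e); split; first by lra.
  move=> y /=; rewrite in_itv/= => /andP[y1 y2].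
  have : `|t - y| < Num.min d e by rewrite ltr_norml; lra.
  by rewrite lt_min => /andP[yd ye]; split=> //; exact: dD.
- by move=> t; exact: cvg_id.
- by move=> t Dt; exists t.
- by apply: continuous_subspaceT; exact: continuous_gauss_fun.
- by move=> t _; exact: expR_gt0.
- apply: (@integrableS _ _ _ _ setT) => //.
  exact: integrableT_gauss.
- by rewrite n_gt0 leqnn.
- exact: within_continuous_prod.
- apply/seteqP; split=> [t [Dt /eqP]|_ [k _ <-]].
    by move/prodf_eq0 => [k _]; rewrite subr_eq0 => /eqP ->; exists k.
  by split=> //; rewrite /s (bigD1 k)//= subrr mul0r.
(* Isolates the only factor vanishing at [x k]. *)
move=> k; have -> : s = fun t => (t - x k) * \prod_(j | j != k) (t - x j).
  by apply/funext => t; rewrite /s (bigD1 k).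
apply: changes_sign_mul => //.
- move=> U oU xU.
  have /nbhs_ballP[e /= e0 eU] : nbhs (x k) (D `&` U).
    by apply: open_nbhs_nbhs; split; [exact: openI|split=> //; exact: xU].
  exists (x k - e / 2), (x k + e / 2); split; [| |lra|lra].
  + by apply: eU; rewrite /ball/= ltr_norml; lra.
  + by apply: eU; rewrite /ball/= ltr_norml; lra.
- exact: within_continuous_prod.
- by apply/prodf_neq0 => j jk; rewrite subr_eq0 (inj_eq injx) eq_sym.
Qed.

(** * The circle and its chords *)

Lemma circle_param_circle (R : realType) (t : R) : circle (circle_param t).
Proof. exact: cos2Dsin2. Qed.

Lemma continuous_circle_param (R : realType) : continuous (@circle_param R).
Proof.
move=> t; apply: (@cvg_pair R R R (nbhs t) (nbhs (cos t)) (nbhs (sin t))).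
  exact: continuous_cos.
exact: continuous_sin.
Qed.

Lemma circle_param_surj (R : realType) :
  @circle R `<=` @circle_param R @` `[0, 2 * pi].
Proof.
move=> [c s] /= cs; have pi0 := pi_gt0 R.
have c1 : -1 <= c <= 1 by rewrite /circle/= in cs; nra.
have [ac0 acpi] : 0 <= acos c /\ acos c <= pi by rewrite acos_ge0// acos_lepi.
have sqrtE : Num.sqrt (1 - c ^+ 2) = `|s|.
  by rewrite -sqrtr_sqr; congr Num.sqrt; move: cs; rewrite /circle/= => <-; ring.
have [s0|s0] := leP 0 s.
  exists (acos c); first by rewrite /= in_itv/=; lra.
  by rewrite /circle_param acosK ?in_itv// sin_acos// sqrtE ger0_norm.
(* The lower half circle, by reflecting the angle and adding a full turn. *)
exists (- acos c + pi *+ 2); first by rewrite /= in_itv/=; lra.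
rewrite /circle_param cosD2pi sinD2pi cosN sinN acosK ?in_itv//.
by rewrite sin_acos// sqrtE ltr0_norm// opprK.
Qed.

(** Equal images force [cos (u - t) = 1], hence a zero of [sin] at [(u - t) / 2], which lies
    strictly between [0] and [pi]. *)
Lemma circle_param_neq (R : realType) (t u : R) :
  t < u < t + 2 * pi -> circle_param t <> circle_param u.
Proof.
move=> tu [ctu stu].
have : cos (u - t) = 1 by rewrite cosB ctu stu -!expr2 cos2Dsin2.
have -> : u - t = ((u - t) / 2) *+ 2 by field.
rewrite cos_mulr2n cos2sin2 => h.
have : 0 < sin ((u - t) / 2) by apply: sin_gt0_pi; lra.
nra.
Qed.

(** The determinant of [z - p] and [q - p], an affine equation of the line through [p] and [q]; it
    replaces the linear factors used on an interval. *)
Definition chord (R : realType) (p q z : R * R) : R :=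
  (z.1 - p.1) * (q.2 - p.2) - (z.2 - p.2) * (q.1 - p.1).

Lemma chordC (R : realType) (p q z : R * R) : chord q p z = - chord p q z.
Proof. by rewrite /chord; ring. Qed.

Lemma continuous_chord (R : realType) (p q : R * R) : continuous (chord p q).
Proof.
move=> z; apply: cvgB; apply: cvgM; try exact: cvg_cst.
- by apply: cvgB; [exact: cvg_fst|exact: cvg_cst].
- by apply: cvgB; [exact: cvg_snd|exact: cvg_cst].
Qed.

Lemma chord_eq0 (R : realType) (p q z : R * R) :
  circle p -> circle q -> circle z -> p <> q ->
  chord p q z = 0 <-> z = p \/ z = q.
Proof.
case: p q z => p1 p2 [q1 q2] [z1 z2]; rewrite /circle/chord/= => cp cq cz pq.
split=> [h|[[-> ->]|[-> ->]]]; [|ring|ring].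
have d0 : 0 < (q1 - p1) ^+ 2 + (q2 - p2) ^+ 2.
  rewrite lt_neqAle addr_ge0 ?sqr_ge0// andbT eq_sym paddr_eq0 ?sqr_ge0//.
  apply/negP => /andP[]; rewrite !sqrf_eq0 !subr_eq0 => /eqP qp1 /eqP qp2.
  by apply: pq; rewrite qp1 qp2.
set dd := _ + _ in d0; have dd0 := lt0r_neq0 d0.
(* The position along the line of the projection of [z]; since [z] lies on the line,
   [z = p + l (q - p)]. The three circle equations then force [l * (l - 1) = 0]. *)
pose l := ((z1 - p1) * (q1 - p1) + (z2 - p2) * (q2 - p2)) / dd.
have lE : l * dd = (z1 - p1) * (q1 - p1) + (z2 - p2) * (q2 - p2).
  by rewrite divfK.
have z1E : z1 = p1 + l * (q1 - p1).
  apply/eqP; rewrite addrC -subr_eq -(inj_eq (mulIf dd0)) mulrAC lE -subr_eq0.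
  apply/eqP.
  transitivity ((q2 - p2) * ((z1 - p1) * (q2 - p2) - (z2 - p2) * (q1 - p1))).
    by rewrite /dd; ring.
  by rewrite h mulr0.
have z2E : z2 = p2 + l * (q2 - p2).
  apply/eqP; rewrite addrC -subr_eq -(inj_eq (mulIf dd0)) mulrAC lE -subr_eq0.
  apply/eqP.
  transitivity ((p1 - q1) * ((z1 - p1) * (q2 - p2) - (z2 - p2) * (q1 - p1))).
    by rewrite /dd; ring.
  by rewrite h mulr0.
have : l * (l - 1) = 0.
  apply: (mulIf dd0); rewrite mul0r.
  transitivity ((p1 + l * (q1 - p1)) ^+ 2 + (p2 + l * (q2 - p2)) ^+ 2 -
    l * (q1 ^+ 2 + q2 ^+ 2) - (1 - l) * (p1 ^+ 2 + p2 ^+ 2)).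
    by rewrite /dd; ring.
  by rewrite -z1E -z2E cz cp cq; ring.
move/eqP; rewrite mulf_eq0 subr_eq0 => /orP[]/eqP l0.
  by left; rewrite z1E z2E l0 !mul0r !addr0.
by right; rewrite z1E z2E l0 !mul1r !subrKC.
Qed.

Lemma chord_changes_sign (R : realType) (p q : R * R) :
  circle p -> circle q -> p <> q ->
  changes_sign_on (@circle R) (chord p q) [set p].
Proof.
move=> cp cq pq U oU pU.
have Up : U p by exact: pU.
(* On the circle [2 * Y] is the squared distance from [p] to [q]. Along the parametrization below,
   the chord is [2 * u * (Y - u * X) / (1 + u ^+ 2)], which has the sign of [u] near [0]. *)
pose Y := 1 - p.1 * q.1 - p.2 * q.2.
pose X := p.1 * q.2 - p.2 * q.1.
have Y0 : 0 < Y.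
  have YE : 2 * Y = (p.1 - q.1) ^+ 2 + (p.2 - q.2) ^+ 2.
    transitivity ((p.1 ^+ 2 + p.2 ^+ 2) + (q.1 ^+ 2 + q.2 ^+ 2) -
      2 * p.1 * q.1 - 2 * p.2 * q.2); last by ring.
    by rewrite cp cq /Y; ring.
  rewrite -(pmulr_rgt0 _ (ltr0n R 2)) YE lt_neqAle addr_ge0 ?sqr_ge0// andbT.
  rewrite eq_sym paddr_eq0 ?sqr_ge0//; apply/negP => /andP[].
  rewrite !sqrf_eq0 !subr_eq0 => /eqP pq1 /eqP pq2; apply: pq.
  by rewrite [p]surjective_pairing [q]surjective_pairing pq1 pq2.
(* The rational parametrization of the circle, started at [p]. *)
pose c (u : R) := (1 - u ^+ 2) / (1 + u ^+ 2).
pose s (u : R) := 2 * u / (1 + u ^+ 2).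
pose z (u : R) : R * R := (p.1 * c u - p.2 * s u, p.2 * c u + p.1 * s u).
have den0 (u : R) : 1 + u ^+ 2 != 0.
  by rewrite lt0r_neq0// ltr_wpDr// sqr_ge0.
have zc u : circle (z u).
  rewrite /circle/=.
  transitivity ((p.1 ^+ 2 + p.2 ^+ 2) * (c u ^+ 2 + s u ^+ 2)).
    by ring.
  by rewrite cp /c /s; field; exact: den0.
have zchord u : chord p q (z u) = 2 * u * (Y - u * X) / (1 + u ^+ 2).
  have -> : Y = p.1 ^+ 2 + p.2 ^+ 2 - p.1 * q.1 - p.2 * q.2 by rewrite cp.
  by rewrite /chord /z /X /c /s /=; field; exact: den0.
have cvg_den : 1 + u ^+ 2 @[u --> (0:R)] --> (1 + 0 ^+ 2 : R).
  by apply: cvgD; [exact: cvg_cst|apply: cvgM; exact: cvg_id].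
have cvg_c : c u @[u --> (0:R)] --> c 0.
  apply: cvgM; last exact: cvgV.
  by apply: cvgB; [exact: cvg_cst|apply: cvgM; exact: cvg_id].
have cvg_s : s u @[u --> (0:R)] --> s 0.
  apply: cvgM; last exact: cvgV.
  by apply: cvgM; [exact: cvg_cst|exact: cvg_id].
have cvg_z : z u @[u --> (0:R)] --> p.
  have -> : p = z 0.
    rewrite /z /c /s expr0n/= subr0 addr0 !mulr0 !mul0r !mulr0 subr0 addr0 divr1.
    by rewrite !mulr1 -surjective_pairing.
  apply: (@cvg_pair R R R (nbhs 0) (nbhs _) (nbhs _)).
    by apply: cvgB; apply: cvgM => //; exact: cvg_cst.
  by apply: cvgD; apply: cvgM => //; exact: cvg_cst.
have nU : \forall u \near (0:R), U (z u).
  by apply: cvg_z; exact: open_nbhs_nbhs.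
have nY : \forall u \near (0:R), 0 < Y - u * X.
  have cvg_Y : Y - u * X @[u --> (0:R)] --> Y - 0 * X.
    apply: cvgB; first exact: cvg_cst.
    by apply: cvgM; [exact: cvg_id|exact: cvg_cst].
  by apply: (cvgr_gt _ cvg_Y); rewrite mul0r subr0.
have /nbhs_ballP[e /= e0 eU] :
    nbhs (0 : R) [set u | U (z u) /\ 0 < Y - u * X] by exact: filterI.
have [|UN YN] := eU (- (e / 2)).
  by rewrite /ball/= sub0r opprK ger0_norm; lra.
have [|UP YP] := eU (e / 2).
  by rewrite /ball/= sub0r normrN ger0_norm; lra.
have den_gt0 (u : R) : 0 < 1 + u ^+ 2 by rewrite ltr_wpDr// sqr_ge0.
exists (z (- (e / 2))), (z (e / 2)); split; [by split|by split| |]; rewrite zchord.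
  by rewrite pmulr_llt0 ?invr_gt0// pmulr_llt0//; lra.
by rewrite divr_gt0// mulr_gt0//; lra.
Qed.

Lemma chord_changes_signr (R : realType) (p q : R * R) :
  circle p -> circle q -> p <> q ->
  changes_sign_on (@circle R) (chord p q) [set q].
Proof.
move=> cp cq pq U oU qU.
have [y [z [Uy Uz yq zq]]] := chord_changes_sign cq cp (nesym pq) oU qU.
exists z, y; split=> //; rewrite -[chord p q _]opprK -chordC.
  by rewrite oppr_lt0.
by rewrite oppr_gt0.
Qed.

(** * Parity of the order on the circle *)

(** A vector in the left kernel would be the coefficients of a nontrivial combination vanishing at
    [n] distinct points. *)
Lemma chebyshev_det_neq0 (R : realType) (T : topologicalType) (D : set T)
    (n : nat) (f : 'I_n -> T -> R) (y : 'I_n -> T) :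
  (0 < n)%N -> chebyshev_system D f -> injective y -> (forall k, D (y k)) ->
  \det (\matrix_(i, j) f i (y j)) != 0.
Proof.
move=> n0 chf injy Dy; apply/det0P => -[v v0 vM].
have : (n < n)%N; last by rewrite ltnn.
apply: (chebyshev_zeros (c := v 0) n0 chf _ injy) => [|k].
  have /rV0Pn[j vj] := v0; by exists j.
split=> //; have /matrixP/(_ 0 k) := vM; rewrite !mxE => vk.
by rewrite -[RHS]vk; apply: eq_bigr => j _; rewrite mxE.
Qed.

(* Rotating [n] equally spaced points by [2 pi / n] permutes the columns of
   the nonvanishing determinant cyclically, a permutation of sign
   [(-1) ^ (n - 1)]. *)
Lemma chebyshev_circle_odd (R : realType) (n : nat) (f : 'I_n -> R * R -> R) :
  (0 < n)%N -> chebyshev_system (@circle R) f -> odd n.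
Proof.
move=> n0 chf; apply/negPn/negP => evenn.
case: n f n0 chf evenn => // n f _ chf evenn.
have n1 : 0 < (n.+1)%:R :> R by rewrite ltr0n.
pose y (t : R) (j : 'I_n.+1) := circle_param (2 * pi * (j%:R + t) / n.+1%:R).
pose F t := \det (\matrix_(i, j) f i (y t j)).
have y_lt t (j k : 'I_n.+1) : (j < k)%N -> y t j <> y t k.
  move=> ltjk; apply: circle_param_neq; have pi0 := pi_gt0 R.
  have jk : j%:R < k%:R :> R by rewrite ltr_nat.
  have kn : k%:R < n.+1%:R :> R by rewrite ltr_nat.
  have j0 : 0 <= j%:R :> R by rewrite ler0n.
  apply/andP; split.
    by rewrite ltr_pM2r ?invr_gt0// ltr_pM2l ?mulr_gt0//; lra.
  rewrite ltr_pdivrMr// (mulrDl _ _ n.+1%:R) divfK ?lt0r_neq0//.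
  by rewrite -mulrDr ltr_pM2l ?mulr_gt0//; lra.
have F0 t : F t != 0.
  apply: chebyshev_det_neq0 chf _ _ => // [j k yjk|k]; last first.
    exact: circle_param_circle.
  by apply/val_inj; case: (ltngtP j k) => // /(y_lt t); rewrite yjk.
have F1 : F 1 = - F 0.
  (* The cycle [j -> j + 1] sending the last index to [0], where the angle [2 pi] wraps around. Its
     sign is [(-1) ^ n] for size [n.+1], and [n] is odd here. *)
  pose sg := lift_perm ord_max ord0 (1%g : {perm 'I_n}).
  have -> : F 1 = \det (col_perm sg (\matrix_(i, j) f i (y 0 j))).
    congr determinant; apply/matrixP => i j; rewrite !mxE; congr (f i _).
    case: (unliftP ord_max j) => [k ->|->].
      by rewrite lift_perm_lift perm1 /y lift_max lift0 addr0 natr1.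
    rewrite lift_perm_id /y /= natr1 mulfK ?lt0r_neq0// addr0 mulr0 mul0r.
    by rewrite /circle_param mulr_natl cos2pi sin2pi cos0 sin0.
  rewrite col_permE det_mulmx det_perm odd_permV odd_lift_perm odd_perm1 /=.
  by move: evenn; rewrite /= negbK => ->; rewrite expr1 mulrN1.
have cF : {within `[0, 1], continuous F}.
  have -> : F = fun t =>
      \sum_(sg : 'S_n.+1) (-1) ^+ sg * \prod_i f i (y t (sg i)).
    apply/funext => t; apply: eq_bigr => sg _; congr (_ * _).
    by apply: eq_bigr => i _; rewrite mxE.
  have cf i j : {within `[0, 1], continuous (fun t => f i (y t j))}.
    apply: (within_continuous_precomp (D := @circle R) (phi := y^~ j)).
    + move=> t; apply: continuous_comp; last exact: continuous_circle_param.
      apply: cvgM; last exact: cvg_cst; apply: cvgM; first exact: cvg_cst.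
      by apply: cvgD; [exact: cvg_cst|exact: cvg_id].
    + by move=> t _; exact: circle_param_circle.
    + exact: chf.1.
  apply: within_continuous_sum => sg t; apply: (@cvgM _ (subspace `[0, 1])).
    exact: cvg_cst.
  exact: within_continuous_prod.
(* [F 0] and [F 1] are opposite, so [F] has a zero, against [F0]. *)
have [|t _ Ft] := @IVT R F 0 1 0 ler01 cF.
  rewrite F1 ge_min le_max oppr_le0 oppr_ge0.
  by rewrite !le_total.
by have := F0 t; rewrite Ft eqxx.
Qed.

(** * The circle case *)

Lemma chebyshev_orthogonal_circle (R : realType) (n : nat) (n_gt0 : (0 < n)%N)
    (f : 'I_n -> R * R -> R) :
  chebyshev_system (@circle R) f ->
  forall x : 'I_n.+1 -> R * R,
    injective x -> (forall k, circle (x k)) ->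
    exists g : R * R -> R,
      [/\ {within @circle R, continuous g},
          sign_changes_at (@circle R) g x
        & forall i, integral_zero `[0, 2 * pi]
            (fun t => g (circle_param t) * f i (circle_param t))].
Proof.
move=> chf x injx cx; have pi0 := pi_gt0 R.
have n_odd := chebyshev_circle_odd n_gt0 chf.
(* Since [n] is odd, the points split into [M] pairs of consecutive indices [k.*2] and [k.*2.+1],
   each spanning a chord. *)
pose X k := x (inord k); pose M := n.+1./2.
have ME : M.*2 = n.+1 by rewrite -[RHS]odd_double_half /= n_odd.
have XE (j : 'I_n.+1) : X j = x j by rewrite /X inord_val.
have Xinj j k : (j < n.+1)%N -> (k < n.+1)%N -> X j = X k -> j = k.
  by move=> jn kn /injx/(congr1 val); rewrite /= !inordK.
have cX k : circle (X k) by exact: cx.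
have lt2 (k : 'I_M) : (k.*2.+1 < n.+1)%N by rewrite -ME ltn_Sdouble.
have lt2' (k : 'I_M) : (k.*2 < n.+1)%N by exact: ltnW (lt2 k).
have Xneq (k : 'I_M) : X k.*2 <> X k.*2.+1.
  by move=> /(Xinj _ _ (lt2' k) (lt2 k))/eqP; rewrite eqn_leq ltnn andbF.
pose ch (k : 'I_M) := chord (X k.*2) (X k.*2.+1).
pose s z := \prod_(k < M) ch k z.
have half_lt (j : 'I_n.+1) : (j./2 < M)%N.
  by rewrite ltn_half_double ME.
(* The index of the only chord through [x j]. *)
pose hf j := Ordinal (half_lt j).
have xhf j : x j = X (hf j).*2 \/ x j = X (hf j).*2.+1.
  have -> : x j = X (odd j + (hf j).*2)%N by rewrite -XE odd_double_half.
  by case: (odd j); [right|left].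
have ch_eq0 k (j : 'I_n.+1) : ch k (x j) = 0 <-> k = hf j.
  split.
    rewrite /ch -[x j]XE => /(chord_eq0 (cX _) (cX _) (cX _) (Xneq k))[].
      move=> /(Xinj _ _ (ltn_ord j) (lt2' k)) jE.
      by apply/val_inj; rewrite /= jE doubleK.
    move=> /(Xinj _ _ (ltn_ord j) (lt2 k)) jE.
    by apply/val_inj; rewrite /= jE /= uphalf_double.
  move=> ->; apply/(chord_eq0 (cX _) (cX _) (cx j) (Xneq (hf j))).
  exact: xhf.
have cch k : {within @circle R, continuous ch k}.
  by apply: continuous_subspaceT; exact: continuous_chord.
apply: (chebyshev_orthogonal
  (phi := @circle_param R) (psi := cst 1) (s := s)) => //.
- exact/hausdorff_accessible/norm_hausdorff.
- apply: fat_points_itv => // t e; rewrite /= in_itv/= => /andP[t0 t2] e0.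
  (* Clipping to the segment leaves a nonempty interval even at its endpoints. *)
  exists (Num.max 0 (t - e)), (Num.min (2 * pi) (t + e)); split.
    by rewrite lt_min !gt_max; lra.
  move=> y; rewrite /= in_itv/= gt_max lt_min.
  move=> /andP[/andP[y0 ty] /andP[y2 yt]]; split.
    by rewrite /= in_itv/= !ltW.
  by rewrite /ball/= ltr_norml; lra.
- exact: continuous_circle_param.
- by move=> t _; exact: circle_param_circle.
- exact: circle_param_surj.
- by move=> t; exact: cvg_cst.
- apply: continuous_compact_integrable; first exact: segment_compact.
  by move=> t; exact: cvg_cst.
- by rewrite n_gt0 leqnSn.
- exact: within_continuous_prod.
- apply/seteqP; split=> [z [cz /eqP]|_ [j _ <-]]; last first.
    by split=> //; rewrite /s (bigD1 (hf j))//= (ch_eq0 _ _).2// mul0r.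
  move/prodf_eq0 => [k _] /eqP/(chord_eq0 (cX _) (cX _) cz (Xneq k))[].
    by move=> ->; exists (inord k.*2).
  by move=> ->; exists (inord k.*2.+1).
move=> j; have -> : s = fun z => ch (hf j) z * \prod_(k | k != hf j) ch k z.
  by apply/funext => z; rewrite /s (bigD1 (hf j)).
apply: changes_sign_mul => //.
- have [->|->] := xhf j; first exact: chord_changes_sign.
  exact: chord_changes_signr.
- exact: within_continuous_prod.
- by apply/prodf_neq0 => k khf; apply/eqP => /ch_eq0 kE; rewrite kE eqxx in khf.
Qed.

Theorem theorem3 (R : realType) (n : nat) (n_gt0 : (0 < n)%N) :
  (forall (a b : \bar R) (f : 'I_n -> R -> R),
     (a < b)%E ->
     chebyshev_system (open_interval a b) f ->
     forall x : 'I_n -> R,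
       injective x -> (forall k, open_interval a b (x k)) ->
       exists g : R -> R,
         [/\ {within open_interval a b, continuous g},
             sign_changes_at (open_interval a b) g x
           & forall i, integral_zero (open_interval a b)
                         (fun t => g t * f i t)])
  /\
  (forall f : 'I_n -> R * R -> R,
     chebyshev_system (@circle R) f ->
     forall x : 'I_n.+1 -> R * R,
       injective x -> (forall k, circle (x k)) ->
       exists g : R * R -> R,
         [/\ {within @circle R, continuous g},
             sign_changes_at (@circle R) g x
           & forall i, integral_zero `[0, 2 * pi]
                         (fun t => g (circle_param t) * f i (circle_param t))]).
Proof.
split=> [a b f _|f]; first exact: chebyshev_orthogonal_interval.
exact: chebyshev_orthogonal_circle.
Qed.
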